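(* Let $f:X\to Y$ be a closed homologically $UV^n(G)$ surjection between paracompact spaces. Then each open cover $\mathcal U$ of $Y$ admits an open refinement $\mathcal V$ (an open cover of $Y$) with the following property: if $A$ is a closed subset of a metric space $M$ and $\varphi:S(A;G)\to S(X;G)$ is a continuous correct $f^{-1}(\mathcal V)$-small chain morphism, then there exist a neighborhood $W$ of $A$ in $M$, an open cover $\omega$ of $W$ and an $f^{-1}(\mathcal U)$-small chain morphism $\widetilde\phi:S^{(n+1)}(W,\omega;G)\to S(X;G)$ such that $\widetilde\phi(c)=\varphi(c)$ for all $c\in S^{(n+1)}(W,\omega;G)\cap S(A;G)$.
   Context: Conventions: all spaces are paracompact, maps are continuous; $G$ is a commutative ring with unit; $n\ge0$ is an integer; $H_k(\cdot;G)$ is singular homology, reduced in dimension $0$. A closed set $A\subset X$ is homologically $UV^n(G)$ if every neighborhood $U$ of $A$ in $X$ contains another neighborhood $V$ of $A$ such that the inclusion induces trivial homomorphisms $H_k(V;G)\to H_k(U;G)$ for all $k\le n$. A surjective map $f:X\to Y$ is homologically $UV^n(G)$ if all fibres $f^{-1}(y)$, $y\in Y$, are homologically $UV^n(G)$-subsets of $X$. For an open cover $\mathcal V$ of $Y$, $f^{-1}(\mathcal V)=\{f^{-1}(V):V\in\mathcal V\}$. A chain morphism is a sequence of homomorphisms of $G$-modules (degree by degree) commuting with the boundaries and, in degree $0$, with the augmentations. $S(X;G)$ is the singular chain complex of $X$. For an open cover $\omega$ of $W$, $S(W,\omega;G)$ is the subcomplex of $S(W;G)$ generated by all singular simplexes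 whose carrier lies in some element of $\omega$, and $S^{(m)}(W,\omega;G)$ is its part in degrees $\le m$. The carrier of a singular simplex $\sigma:\triangle^k\to X$ is $|\sigma|=\sigma(\triangle^k)$; for a chain $c=\sum_i g_i\sigma_i$ (irreducible representation) $|c|=\bigcup_i|\sigma_i|$, and $|0|=\varnothing$. A face of a singular simplex $\sigma$ defined on $\triangle^k$ is the restriction of $\sigma$ to a face of $\triangle^k$. A chain morphism $\varphi$ from a singular complex (or subcomplex spanned by singular simplexes) to $S(X;G)$ is correct if it sends every singular $0$-simplex of its domain to a singular $0$-simplex of $X$. For an open cover $\mathcal W$ of $X$ it is $\mathcal W$-small if for each singular simplex $\sigma$ of the domain there is $W_\sigma\in\mathcal W$ with $|\varphi(\tau)|\subset W_\sigma$ for all faces $\tau$ of $\sigma$. A chain morphism $\varphi:S(Z;G)\to S(X;G)$ is continuous if for every $z\in Z$ and any neighborhood $U$ of $|\varphi(z)|$ in $X$ there is a neighborhood $V$ of $z$ in $Z$ with $|\varphi(z')|\subset U$ for all $z'\in V$ (points of $Z$ being identified with singular $0$-simplexes of $Z$). *)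

(* Defs.v *)
From HB Require Import structures.
From mathcomp Require Import all_boot all_order all_algebra finmap.
From mathcomp Require Import all_classical all_reals all_analysis.
(* Some notations of [monalg] clash with those of MathComp-Analysis. *)
From mathcomp.multinomials Require Import -(notations) monalg.

Set Implicit Arguments.
Unset Strict Implicit.
Unset Printing Implicit Defensive.

Import Order.TTheory GRing.Theory Num.Theory.
Import numFieldNormedType.Exports.

Local Open Scope classical_set_scope.
Local Open Scope ring_scope.

Section Covers.

(* Subsets of [W] open in [W] and open in [T] coincide for the open sets [W]
   to which this is applied. *)
Definition open_cover (T : topologicalType) (W : set T) (C : set (set T)) :=
  (forall B, C B -> open B) /\ \bigcup_(B in C) B = W.

Definition refines (T : Type) (D C : set (set T)) :=
  forall V, D V -> exists2 U, C U & V `<=` U.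

Definition locally_finite (T : topologicalType) (C : set (set T)) :=
  forall x : T, exists2 N, nbhs x N & finite_set [set V | C V /\ V `&` N !=set0].

(* Hausdorff by convention. *)
Definition paracompact (T : topologicalType) :=
  hausdorff_space T /\
  forall C : set (set T), open_cover setT C ->
    exists D, [/\ open_cover setT D, refines D C & locally_finite D].

Definition preimage_cover (X Y : Type) (f : X -> Y) (C : set (set Y)) :
  set (set X) := [set f @^-1` V | V in C].

Definition closed_map (X Y : topologicalType) (f : X -> Y) :=
  forall F, closed F -> closed (f @` F).

End Covers.

Section StandardSimplex.
Variable R : realType.

Definition simplex_set (k : nat) : set 'rV[R]_k.+1 :=
  [set t | (forall i, 0 <= t ord0 i) /\ \sum_i t ord0 i = 1].

Definition std_simplex (k : nat) : topologicalType :=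
  set_type (@simplex_set k).

(* The affine map of standard simplexes sending the vertex [i] to [f i], in
   barycentric coordinates. *)
Definition push_coord (m k : nat) (f : 'I_m.+1 -> 'I_k.+1)
    (t : 'rV[R]_m.+1) : 'rV[R]_k.+1 :=
  \row_j \sum_(i | f i == j) t ord0 i.

Lemma push_coordP m k (f : 'I_m.+1 -> 'I_k.+1) (t : std_simplex m) :
  push_coord f (set_val t) \in @simplex_set k.
Proof.
have /set_mem[t0 t1] := valP t; apply/mem_set; split=> [j|].
  by rewrite mxE; apply: sumr_ge0 => i _; exact: t0.
rewrite -[RHS]t1 [RHS](partition_big f xpredT) //=.
by apply: eq_bigr => j _; rewrite mxE.
Qed.

Definition simplex_map (m k : nat) (f : 'I_m.+1 -> 'I_k.+1)
    (t : std_simplex m) : std_simplex k :=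
  exist (fun u => u \in @simplex_set k) _ (push_coordP f t).

Lemma push_coord_continuous m k (f : 'I_m.+1 -> 'I_k.+1) :
  continuous (push_coord f).
Proof.
move=> t A [P Pt PA].
suff Pu : \forall u \near t, forall i j, P i j (push_coord f u i j).
  by apply: filterS Pu => u Pu; exact: PA.
apply: (@filter_forall _ _ _ (nbhs t)) => i.
apply: (@filter_forall _ _ _ (nbhs t)) => j.
have cf : continuous (fun u : 'rV[R]_m.+1 => \sum_(l | f l == j) u ord0 l).
  apply: continuous_big => [|l _]; first exact: add_continuous.
  exact: coord_continuous.
have Pij : nbhs (\sum_(l | f l == j) t ord0 l) (P i j).
  by have := Pt i j; rewrite mxE.
have sub : (fun u : 'rV[R]_m.+1 => \sum_(l | f l == j) u ord0 l) @^-1` P i j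
    `<=` (fun u => P i j (push_coord f u i j)).
  by move=> u; rewrite /= mxE.
exact: (@filterS _ (nbhs t) _ _ _ sub (cf t _ Pij)).
Qed.

Lemma simplex_map_continuous m k (f : 'I_m.+1 -> 'I_k.+1) :
  continuous (simplex_map f).
Proof.
apply: continuous_comp_initial => t.
have -> : set_val \o simplex_map f = push_coord f \o set_val by [].
apply: continuous_comp; first exact: initial_continuous.
exact: push_coord_continuous.
Qed.

HB.instance Definition _ m k (f : 'I_m.+1 -> 'I_k.+1) :=
  isContinuous.Build _ _ (simplex_map f) (@simplex_map_continuous m k f).

End StandardSimplex.

(* The subspaces [A] of [X] are handled inside [X]: a singular simplex of [A]
   is a singular simplex of [X] with carrier in [A], so that [S(A;G)] is a
   subcomplex of [S(X;G)]. More generally a family [D] of sets of singular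
   simplexes stands for the submodules of [S(X;G)] that it spans. *)
Section SingularChains.
Variables (R : realType) (G : comNzRingType).
Implicit Types X : topologicalType.

Definition sing X (k : nat) : choiceType :=
  continuousType (std_simplex R k) X.

Definition sing_pt X (x : X) : sing X 0%N :=
  mkcts (@cst_continuous (std_simplex R 0%N) X x).

Definition sing_carrier X k (s : sing X k) : set X :=
  range (s : std_simplex R k -> X).

Definition subsing X m k (f : 'I_m.+1 -> 'I_k.+1) (s : sing X k) : sing X m :=
  (s : continuousType _ _) \o simplex_map f.

Definition is_face X m k (t : sing X m) (s : sing X k) :=
  exists2 f : 'I_m.+1 -> 'I_k.+1, {homo f : i j / (i < j)%N} & t = subsing f s.

Definition chain X (k : nat) : lmodType G := malg (sing X k) G.

Definition gen X k (s : sing X k) : chain X k := mkmalgU s 1.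

Definition carrier X k (c : chain X k) : set X :=
  \bigcup_(s in [set s | s \in msupp c]) sing_carrier s.

Definition bdry X k (c : chain X k.+1) : chain X k :=
  \sum_(s <- msupp c) mcoeff s c *:
    \sum_(i < k.+2) (-1) ^+ i *: gen (subsing (lift i) s).

Definition augm X (c : chain X 0%N) : G := \sum_(s <- msupp c) mcoeff s c.

Definition simplex_family X := forall k, set (sing X k).

Definition spanned X (D : simplex_family X) k : set (chain X k) :=
  [set c | forall s, s \in msupp c -> D k s].

Definition sing_in X (A : set X) : simplex_family X :=
  fun k => [set s | sing_carrier s `<=` A].

Definition sing_small X (C : set (set X)) : simplex_family X :=
  fun k => [set s | exists2 B, C B & sing_carrier s `<=` B].

Definition skeleton X (m : nat) (D : simplex_family X) : simplex_family X :=
  fun k => [set s | (k <= m)%N /\ D k s].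

Section Homology.
Variables (X : topologicalType) (A : set X).

(* Reduced: the boundary in degree 0 is the augmentation. *)
Definition cycles (k : nat) : set (chain X k) :=
  match k with
  | 0%N => [set c | spanned (sing_in A) c /\ augm c = 0]
  | l.+1 => [set c | spanned (sing_in A) c /\ bdry c = 0]
  end.

Definition boundaries (k : nat) : set (chain X k) :=
  [set bdry d | d in @spanned X (sing_in A) k.+1].

Definition homology_class k (c : chain X k) : set (chain X k) :=
  [set c' | boundaries (c' - c)].

Definition homology (k : nat) : set (set (chain X k)) :=
  [set homology_class c | c in @cycles k].

End Homology.

(* For [V `<=` U], the map [H_k(V;G) -> H_k(U;G)] induced by the inclusion: the
   union is over classes that all coincide. *)
Definition homology_incl X (U : set X) k (h : set (chain X k)) :
  set (chain X k) := \bigcup_(c in h) homology_class U c.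

Definition homologically_UV X (n : nat) (A : set X) :=
  closed A /\
  forall U, set_nbhs A U -> exists V, [/\ set_nbhs A V, V `<=` U &
    forall k, (k <= n)%N -> forall h, homology V h ->
      homology_incl U h = homology_class U (0 : chain X k)].

Definition homologically_UV_map X (Y : topologicalType) (n : nat)
    (f : X -> Y) :=
  range f = setT /\ forall y, homologically_UV n (f @^-1` [set y]).

Section ChainMorphisms.
Variables Z X : topologicalType.

(* A morphism from the subcomplex spanned by [D] to [S(X;G)] is represented by
   functions on all of [S(Z;G)], whose values off the spans are irrelevant:
   all the notions below only depend on the restrictions to the spans. *)
Definition graded_map := forall k, chain Z k -> chain X k.

Record chain_morphism (D : simplex_family Z) (phi : graded_map) : Prop := {
  chain_morphism_linear : forall k (a : G) (c d : chain Z k),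
    spanned D c -> spanned D d ->
    phi k (a *: c + d) = a *: phi k c + phi k d;
  chain_morphism_bdry : forall k (c : chain Z k.+1),
    spanned D c -> phi k (bdry c) = bdry (phi k.+1 c);
  chain_morphism_augm : forall c : chain Z 0%N,
    spanned D c -> augm (phi 0%N c) = augm c }.

Definition correct (D : simplex_family Z) (phi : graded_map) :=
  forall s, D 0%N s -> exists t, phi 0%N (gen s) = gen t.

Definition small (D : simplex_family Z) (C : set (set X)) (phi : graded_map) :=
  forall k s, D k s -> exists2 B, C B &
    forall m (t : sing Z m), is_face t s -> carrier (phi m (gen t)) `<=` B.

(* Neighborhoods are taken in the subspace [A] of [Z]. *)
Definition continuous_on (A : set Z) (phi : graded_map) :=
  forall z, A z -> forall U, set_nbhs (carrier (phi 0%N (gen (sing_pt z)))) U ->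
    \forall z' \near within A (nbhs z),
      carrier (phi 0%N (gen (sing_pt z'))) `<=` U.

End ChainMorphisms.

End SingularChains.

(* Main.v *)
(** A closed map with homologically UV^n fibres and paracompact target admits,
    for every open cover of [Y], a refinement [D] such that for each [V] in [D]
    the cycles of degree at most [n] in the preimage of the star of [V] in [D]
    bound in the preimage of one element of the given cover.  Iterating gives
    covers [C 0], ..., [C n.+1], with [C n.+1] star-refining [U], and [V] is
    [C 0].  A point [a] of [A] has a ball whose trace on [A] is sent by [phi]
    into the preimage of one element [Q a] of [C 0]; [omega] consists of balls
    four times smaller, so that projecting [W] almost optimally to [A] extends
    [phi] in degree 0, sending the element of [omega] around [a] into the
    preimage of [Q a].  The extension to degree [k.+1] fills the image of the
    boundary of each simplex outside [A]; the invariant is that the simplexes of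
    degree [k] in the element of [omega] around [a] are sent into the preimage
    of the star of [Q a] in [C k].  Mixed simplexes need no separate treatment,
    since [phi] sends a simplex of [A] into the preimage of an element of [C 0]
    that meets [Q a] in the image of a vertex. *)

From HB Require Import structures.
Require Import Defs.
From mathcomp Require Import all_boot all_order all_algebra finmap zify lra.
From mathcomp Require Import all_classical all_reals all_analysis.
From mathcomp.multinomials Require Import -(notations) monalg.

Set Implicit Arguments.
Unset Strict Implicit.
Unset Printing Implicit Defensive.

Import Order.TTheory GRing.Theory Num.Theory.

Local Open Scope classical_set_scope.
Local Open Scope ring_scope.

(** [V] is adjoined explicitly because stars are also taken of sets that are not elements of [C],
    such as elements of a finer cover. *)
Definition star (T : Type) (C : set (set T)) (V : set T) : set T :=
  V `|` \bigcup_(B in [set B | C B /\ B `&` V !=set0]) B.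

Lemma starS (T : Type) (C : set (set T)) (V V' : set T) :
  V `<=` V' -> star C V `<=` star C V'.
Proof.
move=> VV' x [/VV'|[B [CB [y [By /VV' V'y]]] Bx]]; first by left.
by right; exists B => //; split => //; exists y.
Qed.

Lemma star_refines (T : Type) (C D : set (set T)) (V : set T) :
  refines C D -> star C V `<=` star D V.
Proof.
move=> CD x [Vx|[B [CB [y [By Vy]]] Bx]]; first by left.
have [B' DB' BB'] := CD _ CB.
by right; exists B'; [split=> //; exists y; split=> //; exact: BB'|exact: BB'].
Qed.

(** * Star refinements of open covers of paracompact spaces *)

Section Covers.
Variable T : topologicalType.
Implicit Types (C D E : set (set T)) (V W : set T) (x y : T).

Lemma open_coverP C x : open_cover setT C -> exists2 B, C B & B x.
Proof.
by move=> [_ CT]; have : [set: T] x by []; rewrite -CT => -[B ? ?]; exists B.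
Qed.

(** Some neighborhood [N] of [x] meets only finitely many elements of [E]. For [y] interior to [N],
    either alternative makes [V] meet [N], so a finite intersection of the [G V] suffices. *)
Lemma locally_finite_nbhs E (G : set T -> set T) x :
  locally_finite E -> (forall V, E V -> nbhs x (G V)) ->
  nbhs x [set y | forall V, E V -> closure V x \/ closure V y -> G V y].
Proof.
move=> /(_ x)[N Nx finN] GE.
pose F := [set V | E V /\ V `&` N !=set0].
have Gx : nbhs x (\bigcap_(V in F) G V).
  rewrite -(fset_setK (finN : finite_set F)); apply: filter_bigI => V.
  by rewrite in_fset_set// inE => -[/GE].
apply: filterS (filterI (nbhs_interior Nx) Gx) => y [Ny Gy] V EV Vxy.
by apply: Gy; split => //; case: Vxy; apply.
Qed.

Hypothesis pT : paracompact T.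

(** [D] refines the cover by open sets that lie in [W] or whose closure misses [x]. A point of
    [closure S°] off [W] would lie in some [V] of [D] of the second kind; but [V] then meets [S],
    which puts [x] in [closure V]. *)
Lemma paracompact_regular x U : nbhs x U ->
  exists V, [/\ open V, V x & closure V `<=` U].
Proof.
rewrite nbhsE => -[W [oW Wx] WU]; have [hT pcT] := pT.
pose C := [set B : set T | open B /\ (B `<=` W \/ ~ closure B x)].
have [|D [cD DC lD]] := pcT C.
  split=> [B [] //|]; apply/seteqP; split=> // y _.
  have [Wy|nWy] := pselect (W y); first by exists W => //; split=> //; left.
  have xy : x != y by apply/eqP => xy; apply: nWy; rewrite -xy.
  move: hT; rewrite open_hausdorff => /(_ _ _ xy)[[P Q] /= [xP yQ] [oP oQ PQ0]].
  move: PQ0 => /eqP PQ0; exists Q; last exact/set_mem.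
  split=> //; right=> /(_ P (open_nbhs_nbhs (conj oP (set_mem xP))))[z [Qz Pz]].
  by have : (P `&` Q) z by []; rewrite PQ0.
pose S := [set y | forall V, D V -> closure V y -> closure V x].
have Sx : nbhs x S.
  have := @locally_finite_nbhs D
    (fun V => if `[< closure V x >] then setT else ~` closure V) x lD.
  move=> H; apply: filterS (H _) => [y Sy V DV Vy|V DV].
    have := Sy V DV (or_intror Vy); case: asboolP => // _ nVy; exact: nVy.
  case: asboolP => [_|nVx]; first exact: filterT.
  by apply: open_nbhs_nbhs; split=> //; apply: closed_openC; exact: closed_closure.
exists S°; split; [exact: open_interior|exact: Sx|move=> z Sz].
apply: WU; apply: contrapT => nWz.
have [V DV Vz] := open_coverP z cD.
have [B [oB [BW|nBx]] VB] := DC _ DV; first exact: nWz (BW _ (VB _ Vz)).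
have Vz' := open_nbhs_nbhs (conj (cD.1 _ DV) Vz).
have [y [/interior_subset Sy Vy]] := Sz V Vz'.
by apply: nBx; apply: closureS VB _ _; apply: Sy DV _; exact: subset_closure.
Qed.

(** If [y] lies in an element [V] of [E] and in [N x], then [x] lies in [closure V], so all of [N x]
    lies in [u V], a set that does not depend on [x]. *)
Lemma barycentric_refinement C : open_cover setT C ->
  exists D, [/\ open_cover setT D, (forall V, D V -> V !=set0) &
    forall y, exists2 U, C U & forall V, D V -> V y -> V `<=` U].
Proof.
move=> cC.
pose C' := [set B : set T | open B /\ exists2 U, C U & closure B `<=` U].
have [|E [cE EC' lE]] := pT.2 C'.
  split=> [B [] //|]; apply/seteqP; split=> // y _.
  have [U CU Uy] := open_coverP y cC.
  have Uy' := open_nbhs_nbhs (conj (cC.1 _ CU) Uy).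
  have [V [oV Vy VU]] := paracompact_regular Uy'.
  by exists V => //; split=> //; exists U.
have /choice[u uE] : forall V, exists U, E V -> C U /\ closure V `<=` U.
  move=> V; have [EV|nEV] := pselect (E V); last by exists set0.
  have [B [_ [U CU BU]] VB] := EC' _ EV.
  by exists U => _; split=> //; apply: subset_trans BU; exact: closureS.
pose N x := [set y | forall V, E V ->
  (closure V x -> u V y) /\ (closure V y -> closure V x)].
have Nx x : nbhs x (N x).
  have := @locally_finite_nbhs E
    (fun V => if `[< closure V x >] then u V else ~` closure V) x lE.
  move=> H; apply: filterS (H _) => [y Sy V EV|V EV].
    have := Sy V EV; case: asboolP => [Vx SV|nVx SV]; split=> //.
    - by move=> _; apply: SV; left.
    - by move=> Vy; have := SV (or_intror Vy) Vy.
  case: asboolP => [Vx|nVx].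
    have [CU VU] := uE _ EV.
    by apply: open_nbhs_nbhs; split; [exact: cC.1|exact: VU].
  by apply: open_nbhs_nbhs; split=> //; apply: closed_openC; exact: closed_closure.
exists (range (fun x => (N x)°)); split.
- split=> [_ [x _ <-]|]; first exact: open_interior.
  by apply/seteqP; split=> // x _; exists (N x)°; [exists x|exact: Nx].
- by move=> _ [x _ <-]; exists x; exact: Nx.
- move=> y; have [V EV Vy] := open_coverP y cE.
  exists (u V); first by have [] := uE _ EV.
  move=> _ [x _ <-] /interior_subset Nxy z /interior_subset Nxz.
  apply: (Nxz V EV).1; apply: (Nxy V EV).2; exact: subset_closure.
Qed.

(** Two barycentric refinements in a row: with [x] fixed in [V], any [V'] meeting [V] lies together
    with [V] in some element of [B], and all elements of [B] through [x] lie in a single [U]. *)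
Lemma star_refinement C : open_cover setT C ->
  exists D, open_cover setT D /\
    forall V, D V -> exists2 U, C U & star D V `<=` U.
Proof.
move=> /barycentric_refinement[B [/barycentric_refinement[D [cD D0 DB]] _ BC]].
exists D; split=> // V DV; have [x Vx] := D0 _ DV; have [U CU BU] := BC x.
have sub V' : D V' -> V' `&` V !=set0 -> V' `<=` U.
  move=> DV' [y [V'y Vy]]; have [B0 BB0 DB0] := DB y.
  by apply: subset_trans (DB0 _ DV' V'y) _; apply: BU => //; exact: DB0 Vx.
exists U => //; rewrite /star subUset; split.
  by apply: sub => //; exists x.
by apply: bigcup_sub => V' [DV' V'V]; exact: sub.
Qed.

End Covers.

(** * Linear extension of maps defined on generators *)

Section LinearExtension.
Variables (G : comNzRingType) (K : choiceType) (V : lmodType G).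
Implicit Types (g : K -> V) (c d : malg K G).

Definition lin_ext g c : V := \sum_(s <- msupp c) mcoeff s c *: g s.

(** Allows chains with different supports to be summed over one finite set. *)
Lemma lin_extEw g c (D : {fset K}) : (msupp c `<=` D)%fset ->
  lin_ext g c = \sum_(s <- D) mcoeff s c *: g s.
Proof.
move=> cD; rewrite /lin_ext (big_fset_incl _ cD) // => s _ sc.
by rewrite mcoeff_outdom // scale0r.
Qed.

Lemma lin_ext_linear g : linear (lin_ext g).
Proof.
move=> a c d; pose D := (msupp (a *: c + d) `|` (msupp c `|` msupp d))%fset.
rewrite (@lin_extEw g _ D) ?(@lin_extEw g c D) ?(@lin_extEw g d D).
- rewrite scaler_sumr -big_split /=; apply: eq_bigr => s _.
  by rewrite mcoeffD mcoeffZ scalerDl scalerA.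
- by apply/fsubsetP => x; rewrite !inE => ->; rewrite !orbT.
- by apply/fsubsetP => x; rewrite !inE => ->; rewrite !orbT.
- by apply/fsubsetP => x; rewrite !inE => ->.
Qed.

HB.instance Definition _ g :=
  GRing.isLinear.Build G (malg K G) V *:%R (lin_ext g) (lin_ext_linear g).

Lemma lin_ext_gen g s : lin_ext g (mkmalgU s 1) = g s.
Proof. by rewrite /lin_ext msuppU oner_eq0 big_seq_fset1 mcoeffUU scale1r. Qed.

End LinearExtension.

Lemma malg_lin_ext (G : comNzRingType) (K : choiceType) (c : malg K G) :
  c = lin_ext (fun s => mkmalgU s 1 : malg K G) c.
Proof.
rewrite [LHS]monalgE; apply: eq_bigr => s _; apply/malgP => t.
by rewrite mcoeffZ !mcoeffU mulrnAr mulr1.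
Qed.

Lemma linear_lin_ext (G : comNzRingType) (K : choiceType) (V V' : lmodType G)
    (g : K -> V) (h : {linear V -> V'}) c :
  h (lin_ext g c) = lin_ext (h \o g) c.
Proof.
by rewrite /lin_ext linear_sum; apply: eq_bigr => s _; rewrite linearZ.
Qed.

Lemma eq_in_lin_ext (G : comNzRingType) (K : choiceType) (V : lmodType G)
    (g h : K -> V) (c : malg K G) :
  (forall s, s \in msupp c -> g s = h s) -> lin_ext g c = lin_ext h c.
Proof.
move=> gh; rewrite /lin_ext big_seq [RHS]big_seq.
by apply: eq_bigr => s /gh ->.
Qed.

(** * The cancellation of signs in a double boundary *)

Section SimplicialIdentity.
Variables (R : pzRingType) (V : lmodType R) (k : nat).

(** Pairs with [j < i] cancel against pairs with [i <= j]. An arbitrary [H] keeps simplexes out of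
    the index computation. *)
Lemma sum_lift_lift (H : ('I_k.+1 -> 'I_k.+3) -> V) :
  \sum_(i < k.+3) \sum_(j < k.+2) (-1) ^+ (i + j) *: H (lift i \o lift j) = 0.
Proof.
pose F (p : 'I_k.+3 * 'I_k.+2) :=
  (-1) ^+ (p.1 + p.2) *: H (lift p.1 \o lift p.2).
rewrite (pair_big xpredT xpredT (fun i j => F (i, j))) /=.
rewrite (eq_bigr F); last by case.
rewrite (bigID (fun p : 'I_k.+3 * 'I_k.+2 => p.2 < p.1)%N) /=.
(* [h] is the bijection from [i <= j] to [j < i] with
   [lift i \o lift j = lift j.+1 \o lift i]. *)
pose h (p : 'I_k.+3 * 'I_k.+2) : 'I_k.+3 * 'I_k.+2 :=
  (lift ord0 p.2, inord p.1).
pose h' (p : 'I_k.+3 * 'I_k.+2) : 'I_k.+3 * 'I_k.+2 :=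
  (lift ord_max p.2, inord p.1.-1).
rewrite (reindex_onto h h') /=; last first.
  move=> [i j] /= ji; rewrite /h /h' /=; congr pair; apply/val_inj => /=.
    rewrite inordK /bump; have := ltn_ord i; lia.
  rewrite inordK /bump; have := ltn_ord j; lia.
rewrite -[X in X + _]opprK; apply/eqP; rewrite addrC subr_eq0; apply/eqP.
rewrite -sumrN; apply: eq_big => [[i j]|[i j] ij] /=.
  rewrite -leqNgt; apply/idP/idP => [ij|].
    have ik : (i < k.+2)%N by have := ltn_ord j; lia.
    rewrite inordK // /bump /=; apply/andP; split; first by lia.
    by apply/eqP; congr pair; apply/val_inj; rewrite /= ?inordK // /bump;
      have := ltn_ord j; lia.
  move=> /andP[+ /eqP[]] /(congr1 val); rewrite /h /h' /= /bump => ij.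
  by have := ltn_ord (inord i : 'I_k.+2); move: ij; lia.
have ik : (i < k.+2)%N by have := ltn_ord j; rewrite -leqNgt /= in ij; lia.
rewrite /F /h /= inordK // -scaleNr; congr (_ *: H _).
  by rewrite /bump /= add1n addSn exprS mulN1r opprK addnC.
apply/funext => x; apply/val_inj => /=.
by rewrite /bump /= inordK //; rewrite -leqNgt /= in ij; lia.
Qed.

End SimplicialIdentity.

(** * Faces, carriers and boundaries of singular chains *)

Section Chains.
Variables (R : realType) (G : comNzRingType).
Implicit Types (X Z : topologicalType) (k m : nat).

Lemma subsing_comp X m k l (f : 'I_m.+1 -> 'I_k.+1) (g : 'I_k.+1 -> 'I_l.+1)
    (s : sing R X l) : subsing f (subsing g s) = subsing (g \o f) s.
Proof.
apply/continuousEP => t /=; congr (s _); apply/val_inj => /=.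
apply/rowP => j; rewrite !mxE.
rewrite [RHS](partition_big f (fun i => g i == j)) //=.
apply: eq_bigr => i gi; rewrite mxE; apply: eq_bigl => a.
by case: eqP => [->|_]; rewrite ?gi ?andbF.
Qed.

Lemma sing_carrier_subsing X m k (f : 'I_m.+1 -> 'I_k.+1) (s : sing R X k) :
  sing_carrier (subsing f s) `<=` sing_carrier s.
Proof. by move=> _ [t _ <-]; exists (simplex_map f t). Qed.

Lemma sing_carrier_face X m k (t : sing R X m) (s : sing R X k) :
  is_face t s -> sing_carrier t `<=` sing_carrier s.
Proof. by move=> [f _ ->]; exact: sing_carrier_subsing. Qed.

Lemma is_face_dim X m k (t : sing R X m) (s : sing R X k) :
  is_face t s -> (m <= k)%N.
Proof.
move=> [f fi _]; have finj : injective f.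
  move=> i j fij; apply/val_inj.
  by case: (ltngtP i j) => // /fi; rewrite fij ltnn.
by have := leq_card f finj; rewrite !card_ord.
Qed.

Lemma is_face_refl X k (s : sing R X k) : is_face s s.
Proof.
exists idfun => //; apply/continuousEP => t /=; congr (s _).
apply/val_inj/rowP => j; rewrite !mxE (bigD1 j) //= big1 ?addr0 // => i.
by case/andP=> /eqP ->; rewrite eqxx.
Qed.

Lemma std_simplex0_all_eq (t u : std_simplex R 0) : t = u.
Proof.
apply/val_inj/rowP => j; rewrite ord1.
have /set_mem[_] := valP t; have /set_mem[_] := valP u.
by rewrite !big_ord1 => -> ->.
Qed.

Lemma std_simplex0 : std_simplex R 0.
Proof.
exists (const_mx 1); apply/mem_set; split=> [i|]; rewrite ?big_ord1 mxE //.
Qed.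

Lemma sing0E X (s : sing R X 0) : s = sing_pt R (s std_simplex0).
Proof.
by apply/continuousEP => t; rewrite [in LHS](std_simplex0_all_eq t std_simplex0).
Qed.

Lemma sing_carrier_pt X (x : X) : sing_carrier (sing_pt R x) = [set x].
Proof.
by apply/seteqP; split=> [_ [t _ <-] //|_ ->]; exists std_simplex0.
Qed.

(** Anchors a simplex of any dimension at a point, over which elements of the covers are later shown
    to meet. *)
Lemma vertex_face X k (s : sing R X k) :
  exists x, [/\ sing_carrier s x & is_face (sing_pt R x) s].
Proof.
pose t := subsing (fun=> ord0 : 'I_k.+1) s : sing R X 0.
have ts : is_face t s by exists (fun=> ord0) => // i j; rewrite !ord1.
exists (t std_simplex0); rewrite -sing0E; split=> //.
by apply: (sing_carrier_face ts); exists std_simplex0.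
Qed.

Lemma sing_in_face X (A : set X) m k (t : sing R X m) (s : sing R X k) :
  is_face t s -> sing_in A s -> sing_in A t.
Proof. by move=> /sing_carrier_face; exact: subset_trans. Qed.

Lemma carrierP X k (c : chain R G X k) (A : set X) :
  carrier c `<=` A <-> spanned (sing_in A) c.
Proof.
split=> [cA s sc x sx|cA x [s /cA sA /sA//]].
by apply: cA; exists s.
Qed.

Lemma carrier_gen X k (s : sing R X k) : carrier (gen G s) = sing_carrier s.
Proof.
rewrite /carrier /gen msuppU oner_eq0; apply/seteqP; split=> [x [t /=]|x sx].
  by rewrite inE => /eqP ->.
by exists s => //=; rewrite inE.
Qed.

Section Spanned.
Variables (X : topologicalType) (D : simplex_family R X).

Lemma spanned_gen k (s : sing R X k) : D s -> spanned D (gen G s).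
Proof. by move=> Ds t; rewrite msuppU oner_eq0 inE => /eqP ->. Qed.

Lemma spanned0 k : spanned D (0 : chain R G X k).
Proof. by move=> s; rewrite msupp0. Qed.

Lemma spanned_linear k (a : G) (c d : chain R G X k) :
  spanned D c -> spanned D d -> spanned D (a *: c + d).
Proof.
move=> Dc Dd s /(fsubsetP (msuppD_le _ _)); rewrite inE => /orP[|/Dd//].
by move=> /(fsubsetP (msuppZ_le _ _))/Dc.
Qed.

Lemma spanned_sum k I (r : seq I) (P : pred I) (a : I -> G)
    (c : I -> chain R G X k) :
  (forall i, P i -> spanned D (c i)) ->
  spanned D (\sum_(i <- r | P i) a i *: c i).
Proof.
move=> Dc; elim/big_ind: _ => [|c1 c2 D1 D2|i /Dc Di]; first exact: spanned0.
  by rewrite -[c1]scale1r; exact: spanned_linear.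
by rewrite -[_ *: _]addr0; apply: spanned_linear => //; exact: spanned0.
Qed.

Lemma spanned_lin_ext (K : choiceType) k (g : K -> chain R G X k) c :
  (forall s, s \in msupp c -> spanned D (g s)) -> spanned D (lin_ext g c).
Proof. by move=> Dg; rewrite /lin_ext big_seq; exact: spanned_sum. Qed.

(** Linearity is available only on the span, so the induction carries along that each partial sum
    stays in the span. *)
Lemma linear_on_spanned k (V' : lmodType G) (phi : chain R G X k -> V') :
  (forall a c d, spanned D c -> spanned D d ->
    phi (a *: c + d) = a *: phi c + phi d) ->
  forall c, spanned D c -> phi c = lin_ext (fun s => phi (gen G s)) c.
Proof.
move=> phiL c Dc; have phi0 : phi 0 = 0.
  have := phiL 1 0 0 (@spanned0 _) (@spanned0 _).
  by rewrite !scale1r addr0 => /eqP; rewrite eq_sym -subr_eq0 addrK => /eqP.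
rewrite {1}(malg_lin_ext c) /lin_ext big_seq [RHS]big_seq.
apply: (proj2 (big_rec2 (fun x y => spanned D x /\ phi x = y) _ _)) => [|s y x].
  by split=> //; exact: spanned0.
move=> sc [Dx <-]; have Ds := spanned_gen (Dc _ sc).
by split; [exact: spanned_linear|exact: phiL].
Qed.

End Spanned.

Section Boundary.
Variable X : topologicalType.

Definition simplex_bdry k (s : sing R X k.+1) : chain R G X k :=
  \sum_(i < k.+2) (-1) ^+ i *: gen G (subsing (lift i) s).

Lemma bdryE k (c : chain R G X k.+1) : bdry c = lin_ext (@simplex_bdry k) c.
Proof. by []. Qed.

Lemma bdry_gen k (s : sing R X k.+1) : bdry (gen G s) = simplex_bdry s.
Proof. by rewrite bdryE lin_ext_gen. Qed.

Lemma bdry_bdry k (c : chain R G X k.+2) : bdry (bdry c) = 0.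
Proof.
rewrite !bdryE linear_lin_ext /lin_ext big1 // => s _.
rewrite [X in _ *: X](_ : _ = 0) ?scaler0 //= /simplex_bdry linear_sum /=.
rewrite -[RHS](sum_lift_lift (fun u => gen G (subsing u s))).
apply: eq_bigr => i _; rewrite linearZ /= lin_ext_gen scaler_sumr.
by apply: eq_bigr => j _; rewrite scalerA -exprD subsing_comp.
Qed.

Lemma augmE (c : chain R G X 0) : augm c = lin_ext (fun=> 1 : G^o) c.
Proof. by apply: eq_bigr => s _; rewrite -[RHS]/(_ * _) mulr1. Qed.

Lemma augm_gen (s : sing R X 0) : augm (gen G s) = 1.
Proof. by rewrite augmE lin_ext_gen. Qed.

Lemma augm_bdry (c : chain R G X 1) : augm (bdry c) = 0.
Proof.
rewrite augmE bdryE linear_lin_ext /lin_ext big1 // => s _.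
rewrite [X in _ *: X](_ : _ = 0) ?scaler0 //= /simplex_bdry linear_sum /=.
rewrite !big_ord_recl big_ord0 !linearZ /= !lin_ext_gen.
by rewrite -![_ *: _]/(_ * _) expr0 expr1 !mulr1 addr0 subrr.
Qed.

Lemma spanned_simplex_bdry (D : simplex_family R X) k (s : sing R X k.+1) :
  (forall i : 'I_k.+2, D k (subsing (lift i) s)) -> spanned D (simplex_bdry s).
Proof. by move=> Ds; apply: spanned_sum => i _; exact: spanned_gen. Qed.

(** The class of [c] in [V] contains [c], hence so does its image, which is the class of 0 in
    [U]. *)
Lemma homology_incl_fill (U V : set X) k (c : chain R G X k) :
  (forall h, homology V h ->
    homology_incl U h = homology_class U (0 : chain R G X k)) ->
  cycles V c -> exists2 d, spanned (sing_in U) d & bdry d = c.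
Proof.
have refl A : boundaries A (c - c).
  by exists 0; [exact: spanned0|rewrite bdryE linear0 subrr].
move=> triv Vc; have : homology_incl U (homology_class V c) c.
  by exists c; exact: refl.
rewrite triv => [[d Ud dE]|]; last by exists c.
by exists d => //; rewrite dE subr0.
Qed.

End Boundary.

Lemma spanned_lin_ext_bdry X Z (D : simplex_family R X) k
    (g : sing R Z k -> chain R G X k) (s : sing R Z k.+1) :
  (forall i : 'I_k.+2, spanned D (g (subsing (lift i) s))) ->
  spanned D (lin_ext g (simplex_bdry s)).
Proof.
move=> Dg; rewrite linear_sum; under eq_bigr do rewrite linearZ /= lin_ext_gen.
by apply: spanned_sum => i _.
Qed.

(** Reduces the construction of a chain morphism to conditions on single simplexes. *)
Lemma chain_morphism_lin_ext X Z (D : simplex_family R Z)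
    (g : forall k, sing R Z k -> chain R G X k) :
  (forall k (s : sing R Z k.+1), D k.+1 s ->
    lin_ext (g k) (simplex_bdry s) = bdry (g k.+1 s)) ->
  (forall s : sing R Z 0, D 0%N s -> augm (g 0%N s) = 1) ->
  chain_morphism D (fun k => lin_ext (g k)).
Proof.
move=> gb ga; split=> [k a c d _ _|k c Dc|c Dc]; first exact: linearP.
  rewrite !bdryE !linear_lin_ext; apply: eq_in_lin_ext => s /Dc Ds /=.
  exact: gb.
rewrite !augmE linear_lin_ext; apply: (@eq_in_lin_ext _ _ G^o) => s /Dc Ds /=.
by rewrite -augmE ga.
Qed.

End Chains.

(** * Covers of [Y] over which cycles bound after a controlled enlargement *)

Section Filling.
Variables (R : realType) (G : comNzRingType) (X Y : topologicalType).

Definition fills (n : nat) (A B : set X) :=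
  forall k (c : chain R G X k), (k <= n)%N -> cycles A c ->
    exists2 d, spanned (sing_in B) d & bdry d = c.

Lemma cyclesS (A B : set X) k (c : chain R G X k) :
  A `<=` B -> cycles A c -> cycles B c.
Proof.
move=> AB; case: k c => [|k] c [Ac c0]; split=> // s /Ac sA;
  exact: subset_trans AB.
Qed.

Lemma fillsS n (A A' B : set X) : A' `<=` A -> fills n A B -> fills n A' B.
Proof. by move=> A'A AB k c kn /(cyclesS A'A)/AB; apply. Qed.

Variables (n : nat) (f : X -> Y).
Hypotheses (pY : paracompact Y) (cf : continuous f) (clf : closed_map f).
Hypothesis UVf : homologically_UV_map R G n f.

(** The neighborhood [V'] of a fibre need not be a preimage. As [f] is closed, removing from [Y] the
    image of the complement of [V'°] leaves an open neighborhood of [y] whose preimage lies in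
    [V']. *)
Lemma UV_refinement (C : set (set Y)) : open_cover setT C ->
  exists D, open_cover setT D /\ forall V, D V -> exists U,
    [/\ C U, V `<=` U & fills n (f @^-1` V) (f @^-1` U)].
Proof.
move=> cC; have [fT UV] := UVf.
pose D := [set V | open V /\ exists U,
    [/\ C U, V `<=` U & fills n (f @^-1` V) (f @^-1` U)]].
exists D; split; last by move=> V [].
split=> [V [] //|]; apply/seteqP; split=> // y _.
have [U CU Uy] := open_coverP y cC.
have [|V' [nV' V'U triv]] := (UV y).2 (f @^-1` U).
  move=> x /= fxy; apply: cf; rewrite fxy; apply: open_nbhs_nbhs; split=> //.
  exact: cC.1.
exists (~` (f @` (~` V'°))); last first.
  move=> [x nV'x fxy]; apply: nV'x; exact: nV'.
have sub : f @^-1` (~` (f @` (~` V'°))) `<=` V'.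
  move=> x /= nx; apply: interior_subset; apply: contrapT => nV'x.
  by apply: nx; exists x.
split.
  apply: closed_openC; apply: clf; apply: open_closedC; exact: open_interior.
exists U; split=> //.
  (* Surjectivity turns an inclusion of preimages into one in [Y]. *)
  move=> y' ny'; have : range f y' by rewrite fT.
  move=> [x _ fx]; rewrite -fx; apply: V'U; apply: sub.
  by rewrite /preimage /= fx.
move=> k c kn /(cyclesS sub); apply: homology_incl_fill; exact: triv.
Qed.

Lemma star_filling_refinement (C : set (set Y)) : open_cover setT C ->
  exists D, open_cover setT D /\ forall V, D V -> exists U,
    [/\ C U, star D V `<=` U & fills n (f @^-1` star D V) (f @^-1` U)].
Proof.
move=> /UV_refinement[D [/(star_refinement pY)[E [cE ED]] DC]].
exists E; split=> // V /ED[V' DV' VV']; have [U [CU V'U fU]] := DC _ DV'.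
exists U; split=> //; first exact: subset_trans V'U.
by apply: fillsS fU => x; exact: VV'.
Qed.

Definition filling_seq (m : nat) (C : nat -> set (set Y)) :=
  forall k V, (k < m)%N -> C k V -> exists U,
    [/\ C k.+1 U, star (C k) V `<=` U &
        fills n (f @^-1` star (C k) V) (f @^-1` U)].

(** Induction prepends a finer cover at index 0, shifting the others and keeping [U] last. *)
Lemma filling_seq_exists (m : nat) (U : set (set Y)) : open_cover setT U ->
  exists C, [/\ open_cover setT (C 0%N), C m = U & filling_seq m C].
Proof.
move=> cU; elim: m => [|m [C [cC0 CmU CF]]]; first by exists (fun=> U).
have [V [cV VC]] := star_filling_refinement cC0.
exists (fun k => if k is k'.+1 then C k' else V); split=> // -[|k] W km.
  exact: VC.
exact: CF.
Qed.

Lemma filling_seq_refines m C k l :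
  filling_seq m C -> (k <= l)%N -> (l <= m)%N ->
  refines (C k) (C l).
Proof.
move=> CF; elim: l => [|l IH].
  by rewrite leqn0 => /eqP -> _ V CV; exists V.
rewrite leq_eqVlt => /orP[/eqP -> _ V CV|kl lm V /(IH kl (ltnW lm))[V' CV' VV']].
  by exists V.
have [U [CU V'U _]] := CF _ _ lm CV'.
by exists U => //; apply: subset_trans VV' _; apply: subset_trans V'U; left.
Qed.

End Filling.

(** * Almost nearest points of a closed subset of a metric space *)

Section MetricSelection.
Variables (R : realType) (M : metricType R) (A : set M).
Hypothesis clA : closed A.

(* Off [A], [p z] is a point of [A] at distance less than twice that of [A]. *)
Lemma near_selection (r : M -> R) : exists p : M -> M,
  (forall z, A z -> p z = z) /\
  forall a z, A a -> 0 < r a -> ball a (r a / 4) z ->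
    A (p z) /\ ball a (r a) (p z).
Proof.
(* The point [b] depends on [z] alone and must serve every [a] at once. *)
suff /choice[p pP] : forall z, exists b, (A z -> b = z) /\
    forall a, A a -> 0 < r a -> ball a (r a / 4) z -> A b /\ ball a (r a) b.
  exists p; split=> [z|a z]; first exact: (pP z).1.
  exact: (pP z).2.
move=> z; have [Az|nAz] := pselect (A z).
  exists z; split=> // a Aa ra az; split=> //.
  by apply: le_ball az; lra.
have [[a0 Aa0]|nA] := pselect (A !=set0); last first.
  by exists z; split=> // a Aa; case: nA; exists a.
pose S := [set mdist z a | a in A].
have S0 : S !=set0 by exists (mdist z a0), a0.
have [e e0 eS] : exists2 e, 0 < e & lbound S e.
  have : nbhs z (~` A) by apply: open_nbhs_nbhs; split=> //;
    exact: closed_openC.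
  move=> /nbhs_ballP[e /= e0 eA]; exists e => // _ [a Aa <-].
  rewrite leNgt; apply/negP => ze; apply: (eA a) => //.
  by rewrite ballEmdist.
have mgt0 : 0 < inf S by apply: lt_le_trans e0 _; exact: lb_le_inf.
have hS : has_inf S by split=> //; exists e.
have [_ [b Ab <-] bS] := inf_adherent mgt0 hS.
exists b; split=> // a Aa ra; rewrite !ballEmdist /= => az; split=> //.
(* Here [inf S] is below [r a / 4] and [b] is within [2 * inf S] of [z], so the distance from [a] to
   [b] is below three quarters of [r a]. *)
have mz : inf S <= mdist z a by apply: ge_inf; [exists e|exists a].
have := metric_triangle a z b; rewrite metric_sym in mz; lra.
Qed.

End MetricSelection.

(** * Extension of [phi] by filling boundaries, degree by degree *)

Section Extension.
Variables (R : realType) (G : comNzRingType) (X Y : topologicalType).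
Variables (n : nat) (f : X -> Y) (C : nat -> set (set Y)).
Hypothesis CF : filling_seq R G n f n.+1 C.

Variables (M : topologicalType) (A : set M) (phi : graded_map R G M X).
Hypotheses (phiM : chain_morphism (sing_in A) phi)
  (phi_correct : correct (sing_in A) phi)
  (phi_small : small (sing_in A) (preimage_cover f (C 0%N)) phi).

Variables (p : M -> M) (W : M -> set M) (Q : M -> set Y).
Hypotheses (pA : forall z, A z -> p z = z) (C0Q : forall a, A a -> C 0%N (Q a)).
Hypothesis pW : forall a z, A a -> W a z -> A (p z) /\
  carrier (phi (gen G (sing_pt R (p z)))) `<=` f @^-1` Q a.

(* The choice of [a] with [s] in [W a] is not canonical, so the filling is
   controlled for all of them at once; [extension_spec] shows that it exists. *)
Definition extension_step k (g : sing R M k -> chain R G X k)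
    (s : sing R M k.+1) : chain R G X k.+1 :=
  if `[< sing_carrier s `<=` A >] then phi (gen G s) else
  xget 0 [set d | bdry d = lin_ext g (simplex_bdry G s) /\ forall a, A a ->
    sing_carrier s `<=` W a -> carrier d `<=` f @^-1` star (C k.+1) (Q a)].

Fixpoint extension k : sing R M k -> chain R G X k :=
  match k with
  | 0%N => fun s => phi (gen G (sing_pt R (p (s (std_simplex0 R)))))
  | k'.+1 => extension_step (@extension k')
  end.

Lemma extension_in k (s : sing R M k) :
  sing_in A s -> extension s = phi (gen G s).
Proof.
case: k s => [|k] s sA; last by rewrite /= /extension_step; case: asboolP.
rewrite /= pA; last by apply: sA; exists (std_simplex0 R).
by rewrite -sing0E.
Qed.

(** Correctness is used in this form: the carrier is nonempty, so cover elements whose preimages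
    contain it must meet. *)
Lemma phi_pt z : A z -> exists x, carrier (phi (gen G (sing_pt R z))) = [set x].
Proof.
move=> Az; have [|t ->] := phi_correct (s := sing_pt R z).
  by rewrite /sing_in /= sing_carrier_pt => _ ->.
by rewrite carrier_gen (sing0E t) sing_carrier_pt; exists (t (std_simplex0 R)).
Qed.

Lemma meet_Q a a' z : A a -> A a' -> W a z -> W a' z -> Q a `&` Q a' !=set0.
Proof.
move=> Aa Aa' /(pW Aa)[Apz sa] /(pW Aa')[_ sa'].
have [x xE] := phi_pt Apz; exists (f x).
by split; [apply: sa|apply: sa']; rewrite xE.
Qed.

Lemma carrier_phi_star a k (s : sing R M k) : (k <= n.+1)%N -> A a ->
  sing_in A s -> sing_carrier s `<=` W a ->
  carrier (phi (gen G s)) `<=` f @^-1` star (C k) (Q a).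
Proof.
move=> kn Aa sA sW; have [_ [B CB <-] sB] := phi_small sA.
have [z [sz zs]] := vertex_face s.
(* The vertex [z] lies in [A], so [p] fixes it and the bound at [p z] holds at [z]. *)
have [Apz za] := pW Aa (sW _ sz); rewrite (pA (sA _ sz)) in za.
have [x xE] := phi_pt (sA _ sz).
have [B' CB' BB'] := filling_seq_refines CF (leq0n k) kn CB.
have Bs := sB _ _ (is_face_refl s).
move=> u su; right; exists B'; last by apply: BB'; exact: Bs.
split=> //; exists (f x); split; last by apply: za; rewrite xE.
by apply: BB'; apply: (sB _ _ zs); rewrite xE.
Qed.

(** The condition on one simplex required by [chain_morphism_lin_ext]. *)
Definition extends_at k : sing R M k -> Prop :=
  match k with
  | 0%N => fun s => augm (extension s) = 1
  | k'.+1 => fun s =>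
      lin_ext (@extension k') (simplex_bdry G s) = bdry (extension s)
  end.

(** Both conclusions are needed in the induction: the carrier bound on the faces places the image of
    the boundary where cycles bound, and [extends_at] on the faces makes that image a cycle. *)
Lemma extension_spec k (s : sing R M k) a : (k <= n.+1)%N -> A a ->
  sing_carrier s `<=` W a ->
  carrier (extension s) `<=` f @^-1` star (C k) (Q a) /\ extends_at s.
Proof.
move=> + Aa; elim: k s => [|k IH] s kn sW.
  have [Apz za] : _ /\ _ := pW Aa (sW _ (ex_intro2 _ _ (std_simplex0 R) I erefl)).
  split; first by move=> x /za; left.
  have spz : sing_in A (sing_pt R (p (s (std_simplex0 R)))).
    by rewrite /sing_in /= sing_carrier_pt => _ ->.
  by rewrite /= (chain_morphism_augm phiM) ?augm_gen //; exact: spanned_gen.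
have faceW i : sing_carrier (subsing (lift (i : 'I_k.+2)) s) `<=` W a.
  exact: subset_trans (@sing_carrier_subsing _ _ _ _ _ _) sW.
have bW : spanned (fun j => [set t : sing R M j | sing_carrier t `<=` W a])
    (simplex_bdry G s) by exact: spanned_simplex_bdry.
have [sA|nsA] := pselect (sing_carrier s `<=` A).
  rewrite extension_in //; split; first exact: carrier_phi_star.
  have bA : spanned (sing_in A) (simplex_bdry G s).
    apply: spanned_simplex_bdry => i; apply: subset_trans sA.
    exact: sing_carrier_subsing.
  rewrite /extends_at extension_in // -(chain_morphism_bdry phiM).
  2: exact: spanned_gen.
  rewrite bdry_gen (linear_on_spanned (@chain_morphism_linear _ _ _ _ _ _ phiM _) bA).
  by apply: eq_in_lin_ext => t /bA; exact: extension_in.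
(* [filling_seq] applies to elements of [C k], whereas [Q a] belongs to [C 0]; [U0] is an element of
   [C k] containing it. *)
have [U0 CU0 QU0] := filling_seq_refines CF (leq0n k) (ltnW kn) (C0Q Aa).
have [U [CU starU fillU]] := CF kn CU0.
have [|d dU dE] := fillU k (lin_ext (@extension k) (simplex_bdry G s)) kn.
  have sp : spanned (sing_in (f @^-1` star (C k) U0))
      (lin_ext (@extension k) (simplex_bdry G s)).
    apply: spanned_lin_ext_bdry => i; apply/carrierP => x.
    move=> /(IH _ (ltnW kn) (faceW i)).1; exact: starS.
  (* In degree 0, vertices go to chains of augmentation 1, so the augmentation of the boundary,
     which is 0, is preserved. Above, compatibility on the faces turns the boundary of the image
     into the image of a double boundary. *)
  case: k s kn IH sW bW sp {faceW nsA CU0 QU0 U CU starU fillU}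
    => [|k] s kn IH sW bW sp; split=> //.
    rewrite augmE linear_lin_ext -(augm_bdry (gen G s)) bdry_gen augmE.
    apply: (@eq_in_lin_ext _ _ G^o) => t /bW tW /=; rewrite -augmE.
    by have [_ ->] := IH t isT tW.
  rewrite bdryE linear_lin_ext.
  rewrite (@eq_in_lin_ext _ _ _ _
    (lin_ext (@extension k) \o @simplex_bdry _ G _ k)).
    by rewrite -linear_lin_ext -bdryE -bdry_gen bdry_bdry linear0.
  by move=> t /bW tW; have [_ /= ->] := IH t (ltnW kn) tW.
rewrite /extends_at /= /extension_step; case: asboolP => // _.
set P := [set _ | _]; have : P (xget 0 P).
  have dU' : carrier d `<=` f @^-1` U by exact/carrierP.
  suff PN : P !=set0 by exact: xgetPex.
  (* Although [d] was found from [a], it serves every [a']: [Q a'] meets [Q a], which lies in [U],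
     so [U] is part of the star of [Q a'] in [C k.+1]. *)
  exists d; split=> // a' Aa'.
  move=> sW' x /dU' dx.
  right; exists U; last exact: dx.
  split=> //; have [z [sz _]] := vertex_face s.
  have [y [Qy Q'y]] := meet_Q Aa Aa' (sW _ sz) (sW' _ sz).
  by exists y; split=> //; apply: starU; left; exact: QU0.
by move=> [-> PQ]; split=> //; exact: PQ.
Qed.

End Extension.

(** * Choice of the covers and of the balls around [A], and verification of the extension *)

Theorem proposition3p5 (R : realType) (G : comNzRingType) (n : nat)
    (X Y : topologicalType) (f : X -> Y) :
  paracompact X -> paracompact Y ->
  continuous f -> closed_map f -> homologically_UV_map R G n f ->
  forall U : set (set Y), open_cover setT U ->
  exists V : set (set Y), [/\ open_cover setT V, refines V U &
    forall (M : metricType R) (A : set M), closed A ->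
    forall phi : graded_map R G M X,
      chain_morphism (sing_in A) phi ->
      continuous_on A phi ->
      correct (sing_in A) phi ->
      small (sing_in A) (preimage_cover f V) phi ->
    exists (W : set M) (omega : set (set M)) (psi : graded_map R G M X),
      [/\ open W /\ A `<=` W,
          open_cover W omega,
          chain_morphism (skeleton n.+1 (sing_small omega)) psi,
          small (skeleton n.+1 (sing_small omega)) (preimage_cover f U) psi &
          forall k (c : chain R G M k),
            spanned (skeleton n.+1 (sing_small omega)) c ->
            spanned (sing_in A) c -> psi k c = phi k c]].
Proof.
move=> _ pY cf clf UVf U cU.
(* The last cover star-refines [U] because simplexes end up over stars, not elements, of
   [C n.+1]. *)
have [E [cE EU]] := star_refinement pY cU.
have [C [cC0 CE CF]] := filling_seq_exists pY cf clf UVf n.+1 cE.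
have C0E V : C 0%N V -> exists2 B, E B & V `<=` B.
  by rewrite -CE; exact: filling_seq_refines CF (leq0n _) (leqnn _) _.
exists (C 0%N); split=> [//|V /C0E[B /EU[U' UU' BU'] VB]|].
  by exists U' => //; apply: subset_trans VB (subset_trans _ BU') => x; left.
move=> M A clA phi phiM phiC phi_correct phi_small.
(* Continuity of [phi] at [a] gives the radius once an element of [C 0] around the image of [a] is
   fixed; off [A] the pair is a dummy. *)
have /choice[rQ rQP] : forall a, exists rQ : R * set Y, A a ->
    [/\ 0 < rQ.1, C 0%N rQ.2 & forall a', A a' -> ball a rQ.1 a' ->
      carrier (phi 0%N (gen G (sing_pt R a'))) `<=` f @^-1` rQ.2].
  move=> a; have [Aa|nAa] := pselect (A a); last by exists (0, set0).
  have [x xE] := phi_pt phi_correct Aa.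
  have [Q CQ Qx] := open_coverP (f x) cC0.
  have [|e /= e0 eQ] := (nbhs_ballP _ _).1 (phiC a Aa (f @^-1` Q) _).
    rewrite xE => _ ->; apply: cf; apply: open_nbhs_nbhs; split=> //.
    exact: cC0.1.
  by exists (e, Q) => _; split=> // a' Aa' /eQ; exact.
pose r a := (rQ a).1; pose Q a := (rQ a).2.
have r0 a : A a -> 0 < r a by move=> /rQP[].
have C0Q a : A a -> C 0%N (Q a) by move=> /rQP[].
have [p [pA pr]] := near_selection clA r.
pose W a := (ball a (r a / 4))°.
have pW a z : A a -> W a z -> A (p z) /\
    carrier (phi 0%N (gen G (sing_pt R (p z)))) `<=` f @^-1` Q a.
  move=> Aa /interior_subset az; have [Apz apz] := pr a z Aa (r0 _ Aa) az.
  by split=> //; have [_ _] := rQP _ Aa; exact.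
pose psi := @extension R G X Y f C M A phi p W Q.
have psiP k (s : sing R M k) a (kn : (k <= n.+1)%N) (Aa : A a)
    (sW : sing_carrier s `<=` W a) :=
  extension_spec CF phiM phi_correct phi_small pA C0Q pW kn Aa sW.
exists (\bigcup_(a in A) W a), [set W a | a in A], (fun k => lin_ext (psi k)).
split.
- split; first by apply: bigcup_open => a _; exact: open_interior.
  move=> a Aa; exists a => //; apply: nbhsx_ballx.
  by rewrite divr_gt0 // r0.
- split=> [_ [a _ <-]|]; first exact: open_interior.
  by rewrite bigcup_image.
- apply: chain_morphism_lin_ext => [k s [kn]|s [_]] [_ [a Aa <-] sW].
    exact: (psiP _ _ _ kn Aa sW).2.
  exact: (psiP _ _ _ _ Aa sW).2.
- move=> k s [kn [_ [a Aa <-] sW]].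
  (* One [U'] must serve all faces: a face of degree [m] goes over the star of [Q a] in [C m], which
     lies in the star of [B] in [E] whatever [m] is. *)
  have [B EB QB] := C0E _ (C0Q _ Aa); have [U' UU' BU'] := EU _ EB.
  exists (f @^-1` U'); first by exists U'.
  move=> m t ts; rewrite lin_ext_gen.
  have mn : (m <= n.+1)%N := leq_trans (is_face_dim ts) kn.
  have := (psiP _ t _ mn Aa (subset_trans (sing_carrier_face ts) sW)).1.
  move=> tS x /tS /(starS QB); rewrite -CE in BU'.
  move=> /(star_refines (filling_seq_refines CF mn (leqnn _))); exact: BU'.
- move=> k c _ cA.
  rewrite (linear_on_spanned (@chain_morphism_linear _ _ _ _ _ _ phiM _) cA).
  by apply: eq_in_lin_ext => s /cA; exact: extension_in.
Qed.
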